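(* Let $X$ be an infinite Hausdorff topological space and let $*\in\{1,\mathrm{fin}\}$. If $*=1$ assume that $X$ has the Ramsey property, and if $*=\mathrm{fin}$ assume that $X$ has the $\Omega$-Ramsey property. Let $\Phi$ be any non-empty set of subsets of $X$. Then each of the following three equivalences holds. (A) The following are equivalent: (1) $X$ satisfies $S_*(\Phi,\mathcal S)$; (2) $X$ is sequentially separable and satisfies $S_*(\Phi,\Gamma_x')$ for every $x\in X$; (3) $X$ has a countable sequentially dense subset $D$ such that $S_*(\Phi,\Gamma_x')$ holds for every $x\in D$. (B) The following are equivalent: (1) TWO has a winning strategy in $G_*(\Phi,\mathcal S)$; (2) $X$ is sequentially separable and TWO has a winning strategy in $G_*(\Phi,\Gamma_x')$ for every $x\in X$; (3) $X$ has a countable sequentially dense subset $D$ such that TWO has a winning strategy in $G_*(\Phi,\Gamma_x')$ for every $x\in D$. (C) The following are equivalent: (1) TWO has a winning Markov strategy in $G_*(\Phi,\mathcal S)$; (2) $X$ is sequentially separable and TWO has a winning Markov strategy in $G_*(\Phi,\Gamma_x')$ for every $x\in X$; (3) $X$ has a countable sequentially dense subset $D$ such that TWO has a winning Markov strategy in $G_*(\Phi,\Gamma_x')$ for every $x\in D$.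
   Context: Convergence of sets: a set $A\subseteq X$ converges to $x$, written $x=\lim A$, if $A$ is infinite, $x\notin A$, and $A\setminus U$ is finite for every neighborhood $U$ of $x$; in addition, by convention, $x=\lim\{x\}$. $\Gamma_x=\{A\subseteq X: x=\lim A\}$, and $\Gamma_x'=\{A\subseteq X:\exists B\in\Gamma_x\ (B\subseteq A)\}$. The sequential closure $[A]_{seq}$ of $A\subseteq X$ is the set of all limits of (convergent) sequences of points of $A$. A set $D\subseteq X$ is sequentially dense if $[D]_{seq}=X$. $\mathcal S$ is the family of all sequentially dense subsets of $X$. $X$ is sequentially separable if it has a countable sequentially dense subset. Ramsey property: for any points $x_{i,j}\in X$ ($i,j\in\omega$) such that for each $i$ the sequence $(x_{i,j})_{j\in\omega}$ converges to a point $x_i\in X$ and the sequence $(x_i)_{i\in\omega}$ converges to a point $x\in X$, there is an infinite $M\subseteq\omega$ such that for every open neighborhood $U$ of $x$ there is $k\in\omega$ with $x_{m,n}\in U$ for all $m,n\in M$ with $k\le m<n$. $\Omega$-Ramsey property: for any finite sets $T_{i,j}\subseteq X$ ($i,j\in\omega$) and points $x_i,x\in X$ such that for each $i$ every neighborhood of $x_i$ contains $T_{i,j}$ for all but finitely many $j$, and the sequence $(x_i)_{i\in\omega}$ converges to $x$, there is an infinite $M\subseteq\omega$ such that for every open neighborhood $U$ of $x$ there is $k\in\omega$ with $T_{m,n}\subseteq U$ for all $m,n\in M$ with $k\le m<n$. Selection principles: $S_1(\mathcal A,\mathcal B)$ means that for each sequence $(A_n)_{n\in\omega}$ of elements of $\mathcal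 A$ there are $b_n\in A_n$ with $\{b_n:n\in\omega\}\in\mathcal B$. $S_{\mathrm{fin}}(\mathcal A,\mathcal B)$ means that for each sequence $(A_n)_{n\in\omega}$ of elements of $\mathcal A$ there are finite $B_n\subseteq A_n$ with $\bigcup_{n}B_n\in\mathcal B$. Games: in $G_{\mathrm{fin}}(\mathcal A,\mathcal B)$, in round $n\in\omega$ ONE plays $A_n\in\mathcal A$ and TWO responds with a finite $B_n\subseteq A_n$; TWO wins if $\bigcup_n B_n\in\mathcal B$, otherwise ONE wins. $G_1(\mathcal A,\mathcal B)$ is the same except that TWO chooses a single point $b_n\in A_n$ and wins if $\{b_n:n\in\omega\}\in\mathcal B$. A strategy for TWO is a function $\sigma$ assigning to each finite sequence $\langle A_0,\dots,A_n\rangle$ of moves of ONE a legal response to $A_n$; a Markov strategy is a function $\sigma$ assigning to each $A\in\mathcal A$ and $n\in\omega$ a legal response $\sigma(A,n)$ to $A$ in round $n$. A (Markov) strategy is winning if TWO wins every play in which TWO follows it. *)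

(* Defs.v *)
From mathcomp Require Import all_boot all_order.
From mathcomp Require Import boolp classical_sets functions cardinality filter.
From mathcomp Require Import topology.

Set Implicit Arguments.
Unset Strict Implicit.
Unset Printing Implicit Defensive.

Local Open Scope classical_set_scope.

Section SequentialNotions.
Context {X : topologicalType}.
Implicit Types (A D : set X) (x : X).

(* The second disjunct is the convention x = lim {x}. *)
Definition set_converges A x : Prop :=
  [/\ infinite_set A, ~ A x & forall U, nbhs x U -> finite_set (A `\` U)]
  \/ A = [set x].

Definition Gamma x : set (set X) := [set A | set_converges A x].

Definition Gamma' x : set (set X) := [set A | exists2 B, Gamma x B & B `<=` A].

Definition seq_closure A : set X :=
  [set x | exists2 u : nat -> X, (forall n, A (u n)) & u @ \oo --> x].

Definition seq_dense D : Prop := seq_closure D = [set: X].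

Definition seq_dense_sets : set (set X) := [set D | seq_dense D].

End SequentialNotions.

Definition seq_separable (X : topologicalType) : Prop :=
  exists D : set X, countable D /\ seq_dense D.

Definition ramsey_property (X : topologicalType) : Prop :=
  forall (xx : nat -> nat -> X) (y : nat -> X) (x : X),
    (forall i, xx i @ \oo --> y i) -> y @ \oo --> x ->
    exists2 M : set nat, infinite_set M &
      forall U, open_nbhs x U -> exists k : nat,
        forall m n, M m -> M n -> (k <= m < n)%N -> U (xx m n).

Definition Omega_ramsey_property (X : topologicalType) : Prop :=
  forall (T : nat -> nat -> set X) (y : nat -> X) (x : X),
    (forall i j, finite_set (T i j)) ->
    (forall i U, nbhs (y i) U -> finite_set [set j | ~ (T i j `<=` U)]) ->
    y @ \oo --> x ->
    exists2 M : set nat, infinite_set M &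
      forall U, open_nbhs x U -> exists k : nat,
        forall m n, M m -> M n -> (k <= m < n)%N -> T m n `<=` U.

Section SelectionPrinciplesAndGames.
Context {X : Type}.
Implicit Types (Phi Psi : set (set X)).

Definition S1 Phi Psi : Prop :=
  forall A : nat -> set X, (forall n, Phi (A n)) ->
    exists2 b : nat -> X, (forall n, A n (b n)) & Psi (range b).

Definition Sfin Phi Psi : Prop :=
  forall A : nat -> set X, (forall n, Phi (A n)) ->
    exists2 B : nat -> set X,
      (forall n, finite_set (B n) /\ B n `<=` A n) & Psi (\bigcup_n B n).

(* A strategy maps the list of ONE's moves so far to TWO's response; it is a
   total function, constrained only on nonempty lists of elements of Phi.
   In the play where ONE's moves are A 0, A 1, ..., TWO's response in round n
   is the value on mkseq A n.+1 = [:: A 0; ...; A n]. *)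
Definition legal_strategy1 Phi (s : seq (set X) -> X) : Prop :=
  forall (h : seq (set X)) (A : set X),
    (forall B, B \in h -> Phi B) -> Phi A -> A (s (rcons h A)).

Definition legal_strategyfin Phi (s : seq (set X) -> set X) : Prop :=
  forall (h : seq (set X)) (A : set X),
    (forall B, B \in h -> Phi B) -> Phi A ->
    finite_set (s (rcons h A)) /\ s (rcons h A) `<=` A.

Definition two_wins1 Phi Psi : Prop :=
  exists2 s : seq (set X) -> X, legal_strategy1 Phi s &
    forall A : nat -> set X, (forall n, Phi (A n)) ->
      Psi (range (fun n => s (mkseq A n.+1))).

Definition two_winsfin Phi Psi : Prop :=
  exists2 s : seq (set X) -> set X, legal_strategyfin Phi s &
    forall A : nat -> set X, (forall n, Phi (A n)) ->
      Psi (\bigcup_n s (mkseq A n.+1)).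

Definition two_markov_wins1 Phi Psi : Prop :=
  exists2 s : set X -> nat -> X, (forall A n, Phi A -> A (s A n)) &
    forall A : nat -> set X, (forall n, Phi (A n)) ->
      Psi (range (fun n => s (A n) n)).

Definition two_markov_winsfin Phi Psi : Prop :=
  exists2 s : set X -> nat -> set X,
    (forall A n, Phi A -> finite_set (s A n) /\ s A n `<=` A) &
    forall A : nat -> set X, (forall n, Phi (A n)) ->
      Psi (\bigcup_n s (A n) n).

End SelectionPrinciplesAndGames.

Inductive selection_kind : Set := One | Fin.

Definition ramsey_for (k : selection_kind) (X : topologicalType) : Prop :=
  match k with
  | One => ramsey_property X
  | Fin => Omega_ramsey_property X
  end.

Definition selection (k : selection_kind) {X : Type} :
    set (set X) -> set (set X) -> Prop :=
  match k with One => S1 | Fin => Sfin end.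

Definition two_wins (k : selection_kind) {X : Type} :
    set (set X) -> set (set X) -> Prop :=
  match k with One => two_wins1 | Fin => two_winsfin end.

Definition two_markov_wins (k : selection_kind) {X : Type} :
    set (set X) -> set (set X) -> Prop :=
  match k with One => two_markov_wins1 | Fin => two_markov_winsfin end.

(* Main.v *)
Require Import Defs.
From mathcomp Require Import all_boot all_order.
From mathcomp Require Import boolp classical_sets functions cardinality filter.
From mathcomp Require Import topology.
Local Open Scope classical_set_scope.

(** Two observations carry the proof.

    First, let [D] be sequentially dense. In a Hausdorff space with the Ramsey
    property, a set is sequentially dense exactly when it belongs to
    [Gamma' d] for every [d] in [D]. One direction
    ([seq_dense_sub_Gamma']) holds because a point [x] of the set is the limit
    of [{x}], while a sequence that converges to a point outside its range has
    an infinite range converging to that point as a set.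
    For the other ([seq_dense_Gamma']), given [x], take points [y i] of [D]
    converging to [x] and, for each [i], points [v i j] of the set converging
    to [y i]; the Ramsey property extracts from this array a sequence that
    converges to [x]. The Omega-Ramsey property, applied to singletons, gives
    the Ramsey property, so both kinds of selection use the same argument.

    Second, a player who can meet each of countably many upward closed
    objectives can meet all of them in a single play
    ([informed_win_bigcap]): cut the rounds into infinitely many infinite
    blocks and follow the [i]-th strategy on the [i]-th block.

    Applied to the countably many objectives [Gamma' d], these two facts yield
    the implication from (3) to (1). For the implication from (1) to (2), TWO's
    responses in any single play already form a countable sequentially dense
    set.

    Selection principles, strategies and Markov strategies differ only in which
    of ONE's moves TWO's response in round [n] may depend on: all of them,
    those of rounds at most [n], or that of round [n] alone. The predicate
    [informed_win] has this pattern of information as a parameter, and the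
    three equivalences are instances of [informed_win_equivalences]. *)

(** * Sequences and the families of supersets of convergent sets *)

Lemma eventually_cofinite (P : set nat) :
  (\forall n \near \oo, P n) <-> finite_set [set n | ~ P n].
Proof.
split=> [[N _ NP]|finP].
  apply: sub_finite_set (finite_II N) => n /= nP.
  by rewrite ltnNge; apply/negP => /NP.
have [N PN] : exists N, [set n | ~ P n] `<=` `I_N.
  have /finite_seqP[s sP] := finP.
  exists (\max_(n <- s) n).+1 => n; rewrite sP /= => ns.
  by rewrite ltnS; apply: leq_bigmax_seq.
exists N => // n /= Nn; apply: contrapT => /PN /=.
by rewrite ltnNge Nn.
Qed.

Lemma infinite_nat_unbounded (M : set nat) (n : nat) :
  infinite_set M -> exists2 m, M m & n <= m.
Proof.
move=> infM; apply: contrapT => noM; apply: infM.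
apply: sub_finite_set (finite_II n) => m Mm /=.
by rewrite ltnNge; apply/negP => nm; apply: noM; exists m.
Qed.

(** An infinite set converging to [x] contains an injective sequence; by
    injectivity, only finitely many of its terms avoid a neighborhood. *)
Lemma Gamma'_sub_seq_closure {X : topologicalType} (x : X) (E : set X) :
  Gamma' x E -> seq_closure E x.
Proof.
case=> B [[infB _ Bx]|->] BE; last first.
  by exists (fun=> x) => [n|]; [exact: BE | exact: cvg_cst].
(* Choosing preimages under a surjection from B onto nat gives the injection. *)
have /infiniteP/pcard_surjP[g gB] := infB.
have /choice[u uP] (n : nat) : exists y, B y /\ g y = n.
  by have [y By gy] := gB n I; exists y.
exists u => [n|U xU]; first exact: BE (uP n).1.
apply/eventually_cofinite.
apply: (@sub_finite_set _ _ (u @^-1` (B `\` U))) => [n nU|].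
  by split=> //; exact: (uP n).1.
apply: finite_preimage (Bx U xU) => m n _ _ umn.
by rewrite -(uP m).2 umn (uP n).2.
Qed.

(** If [x] lies in [E], the convention [x = lim {x}] applies. Otherwise the
    range of a sequence in [E] converging to [x] is infinite: a finite range is
    closed and misses [x], so its complement would be a neighborhood of [x]
    that contains no term. *)
Lemma seq_closure_sub_Gamma' {X : topologicalType} (x : X) (E : set X) :
  hausdorff_space X -> seq_closure E x -> Gamma' x E.
Proof.
move=> hX [u uE ux]; have [Ex|nEx] := pselect (E x).
  by exists [set x]; [right | move=> _ ->].
have nux : ~ range u x by case=> n _ unx; apply: nEx; rewrite -unx.
exists (range u); last by move=> _ [n _ <-].
left; split=> // [finu|U xU].
  have /accessible_finite_set_closed/(_ _ finu) clu := hausdorff_accessible hX.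
  have [N _ uN] : \forall n \near \oo, (~` range u) (u n).
    by apply: ux; apply: open_nbhs_nbhs; split=> //; exact: closed_openC.
  by apply: (uN N) => /=; [exact: leqnn | exists N].
have /eventually_cofinite fin := ux _ xU.
apply: sub_finite_set (finite_image u fin) => _ [[n _ <-] nU].
by exists n.
Qed.

Lemma Omega_ramsey_ramsey {X : topologicalType} :
  Omega_ramsey_property X -> ramsey_property X.
Proof.
move=> rX v y x vy yx.
have [|i U yU|//|M infM MU] := rX (fun i j => [set v i j]) y x.
- by move=> *; exact: finite_set1.
- have /eventually_cofinite := vy i U yU.
  by apply: sub_finite_set => j /= nsub; apply: contra_not nsub => Uv _ ->.
exists M => // U xU; have [k kU] := MU U xU.
by exists k => m n Mm Mn kmn; exact: (kU m n Mm Mn kmn).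
Qed.

Lemma ramsey_for_ramsey {X : topologicalType} k :
  ramsey_for k X -> ramsey_property X.
Proof. by case: k => //; exact: Omega_ramsey_ramsey. Qed.

(** The Ramsey property gives an infinite [M] controlling [v m n] for [m < n] in
    [M]; any choice of pairs [m < n] in [M] with [m] tending to infinity is then
    a sequence converging to [x]. *)
Lemma seq_dense_Gamma' {X : topologicalType} (D E : set X) :
  ramsey_property X -> seq_dense D -> (forall d, D d -> Gamma' d E) ->
  seq_dense E.
Proof.
move=> rX dD GE; apply/seteqP; split=> // x _.
have [y yD yx] : seq_closure D x by rewrite dD.
have /choice[v vP] (i : nat) : exists v : nat -> X,
    (forall j, E (v j)) /\ v @ \oo --> y i.
  by have [v] := Gamma'_sub_seq_closure _ _ (GE _ (yD i)); exists v.
have [M infM MU] := rX v y x (fun i => (vP i).2) yx.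
have /choice[p pP] (n : nat) : exists p : nat * nat,
    [/\ M p.1, M p.2 & n <= p.1 < p.2].
  have [a Ma na] := infinite_nat_unbounded M n infM.
  have [b Mb ab] := infinite_nat_unbounded M a.+1 infM.
  by exists (a, b); split=> //; rewrite na.
exists (fun n => v (p n).1 (p n).2); first by move=> n; exact: (vP _).1.
move=> U; rewrite nbhsE => -[V xV VU].
have [k kV] := MU V xV; exists k => // n /= kn; apply: VU.
have [Ma Mb /andP[na ab]] := pP n.
by apply: kV => //; rewrite (leq_trans kn).
Qed.

Lemma seq_dense_sub_Gamma' {X : topologicalType} (x : X) :
  hausdorff_space X -> seq_dense_sets `<=` Gamma' x.
Proof.
move=> hX E dE; apply: seq_closure_sub_Gamma' => //.
by have -> : seq_closure E = setT.
Qed.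

(** * Plays with partial information *)

(** A common vocabulary for the selection of single points and of finite sets.
*)
Definition response (k : selection_kind) (X : Type) : Type :=
  match k with One => X | Fin => set X end.

Definition legal {k : selection_kind} {X : Type} (A : set X) :
    response k X -> Prop :=
  match k with
  | One => fun b => A b
  | Fin => fun B => finite_set B /\ B `<=` A
  end.

Definition outcome {k : selection_kind} {X : Type} :
    (nat -> response k X) -> set X :=
  match k with
  | One => fun b => range b
  | Fin => fun B => \bigcup_n B n
  end.

(** TWO's responses are a function of ONE's entire play, and locality with
    respect to [I] says what TWO really sees: the response in round [n] depends
    only on the moves made in the rounds of [I n]. *)
Definition informed_win (k : selection_kind) (I : nat -> set nat) {X : Type}
    (Phi Psi : set (set X)) : Prop :=
  exists s : (nat -> set X) -> nat -> response k X,
    [/\ forall A n, (forall m, Phi (A m)) -> legal (A n) (s A n),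
        forall A A' n, (forall m, Phi (A m)) -> (forall m, Phi (A' m)) ->
          (forall m, I n m -> A m = A' m) -> s A n = s A' n &
        forall A, (forall m, Phi (A m)) -> Psi (outcome (s A))].

Lemma outcome_reindex {k} {X : Type} (r : nat -> response k X)
    (e : nat -> nat) :
  outcome (r \o e) `<=` outcome r.
Proof.
by case: k r => r x /= [n _ rnx]; exists (e n).
Qed.

Lemma countable_outcome {k} {X : Type} (A : nat -> set X)
    (r : nat -> response k X) :
  (forall n, legal (A n) (r n)) -> countable (outcome r).
Proof.
case: k r => r rA /=;
  first exact: card_le_trans (card_image_le _ _) (countableP _).
apply: bigcup_countable => // n _; apply: finite_set_countable.
by have [] := rA n.
Qed.

Lemma informed_win_mono k I {X : Type} (Phi Psi Psi' : set (set X)) :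
  Psi `<=` Psi' -> informed_win k I Phi Psi -> informed_win k I Phi Psi'.
Proof. by move=> le [s [sl si sw]]; exists s; split=> // A /sw/le. Qed.

(** In the play where ONE repeats one and the same move, TWO collects a countable
    set. *)
Lemma informed_win_countable k I {X : Type} (Phi Psi : set (set X)) :
  Phi !=set0 -> informed_win k I Phi Psi -> exists2 D, countable D & Psi D.
Proof.
move=> [A0 PA0] [s [sl _ sw]]; exists (outcome (s (fun=> A0))).
  by apply: countable_outcome => n; exact: sl.
exact: sw.
Qed.

(** * Interleaving countably many strategies *)

(** The decomposition [n + 1 = 2 ^ i * (2 * j + 1)] makes round [n] the [j]-th
    round of block [i]. Unlike for an arbitrary bijection with pairs of
    integers, [slot i] is increasing, so the blocks respect the order of play.
*)
Definition slot (i j : nat) : nat := (2 ^ i * j.*2.+1).-1.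
Definition row (n : nat) : nat := logn 2 n.+1.
Definition col (n : nat) : nat := (n.+1 %/ 2 ^ row n)./2.

Lemma slotS i j : (slot i j).+1 = 2 ^ i * j.*2.+1.
Proof. by rewrite prednK // muln_gt0 expn_gt0. Qed.

Lemma rowK i j : row (slot i j) = i.
Proof.
by rewrite /row slotS mulnC logn_Gauss ?pfactorK // coprime2n /= odd_double.
Qed.

Lemma colK i j : col (slot i j) = j.
Proof. by rewrite /col rowK slotS mulKn ?expn_gt0 //= uphalf_double. Qed.

Lemma slot_row_col n : slot (row n) (col n) = n.
Proof.
apply: succn_inj; rewrite slotS /col.
have [m cm En] := pfactor_coprime (isT : prime 2) (ltn0Sn n).
have -> : n.+1 %/ 2 ^ row n = m by rewrite En mulnK ?expn_gt0.
rewrite [RHS]En mulnC; congr (_ * _).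
by rewrite -[RHS]odd_double_half -coprime2n cm.
Qed.

Lemma slot_mono i : {homo slot i : j j' / j < j'}.
Proof.
move=> j j' jj'; rewrite -ltnS !slotS ltn_pmul2l ?expn_gt0 //.
by rewrite ltnS ltn_double.
Qed.

(** A player who attends only to the rounds [e 0 < e 1 < ...] sees, in the actual
    play, at least what the player of the subgame is supposed to see. *)
Definition reindexable (I : nat -> set nat) : Prop :=
  forall (e : nat -> nat) n m, {homo e : j j' / j < j'} ->
    I n m -> I (e n) (e m).

(** In round [slot i j] TWO answers as the [i]-th strategy would in round [j] of
    the play made of ONE's moves in block [i]. The responses in block [i] already
    meet objective [i], and the remaining ones only enlarge the outcome. *)
Lemma informed_win_bigcap k I {X : Type} (Phi : set (set X))
    (Psi : nat -> set (set X)) :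
  reindexable I -> (forall i E F, E `<=` F -> Psi i E -> Psi i F) ->
  (forall i, informed_win k I Phi (Psi i)) ->
  informed_win k I Phi (\bigcap_i Psi i).
Proof.
move=> reI upPsi /choice[s sP].
exists (fun A n => s (row n) (A \o slot (row n)) (col n)); split.
- move=> A n PA; have [sl _ _] := sP (row n).
  rewrite -[X in legal (A X)]slot_row_col.
  by apply: (sl (A \o _)) => m; exact: PA.
- move=> A A' n PA PA' AA'; have [_ si _] := sP (row n).
  apply: si => [m|m|m Im] //=; apply: AA'.
  rewrite -[X in I X](slot_row_col n).
  by apply: reI Im; exact: slot_mono.
- move=> A PA i _; have [_ _ sw] := sP i.
  apply: upPsi (sw (A \o slot i) (fun m => PA _)).
  set r := fun n => _; suff -> : s i (A \o slot i) = r \o slot i.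
    exact: outcome_reindex.
  by apply/funext => j; rewrite /r /= rowK colK.
Qed.

Theorem informed_win_equivalences k I {X : topologicalType}
    (Phi : set (set X)) :
  reindexable I -> [set: X] !=set0 -> hausdorff_space X ->
  ramsey_property X -> Phi !=set0 ->
  [<-> informed_win k I Phi seq_dense_sets;
       seq_separable X /\ (forall x : X, informed_win k I Phi (Gamma' x));
       exists D : set X, [/\ countable D, seq_dense D &
         forall x, D x -> informed_win k I Phi (Gamma' x)]].
Proof.
move=> reI [x0 _] hX rX Phi0; tfae.
- move=> win; split; last first.
    by move=> x; apply: informed_win_mono win; exact: seq_dense_sub_Gamma'.
  by have [D cD dD] := informed_win_countable k I Phi _ Phi0 win; exists D.
- by move=> [[D [cD dD]] win]; exists D; split=> // x _; exact: win.
- move=> [D [cD dD win]].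
  have [u uD _] : seq_closure D x0 by rewrite dD.
  have /pfcard_geP[D0|/surjfunPex[d dE]] := cD.
    by have := uD 0; rewrite D0.
  apply: (@informed_win_mono _ _ _ _ (\bigcap_i Gamma' (d i))).
    move=> E GE; apply: (seq_dense_Gamma' D) => // y; rewrite dE => -[i _ <-].
    exact: GE.
  apply: informed_win_bigcap => // [i E F EF [B GB BE]|i].
    by exists B => //; exact: subset_trans EF.
  by apply: win; rewrite dE; exists i.
Qed.

(** * The three modes of play as information patterns *)

(** A selection principle grants a response sequence for each play separately;
    the axiom of choice turns these into one function of the play, on which
    locality imposes nothing. *)
Lemma selectionE k {X : Type} (Phi Psi : set (set X)) : Phi !=set0 ->
  selection k Phi Psi = informed_win k (fun=> setT) Phi Psi.
Proof.
move=> [A0 PA0].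
have -> : selection k Phi Psi = forall A, (forall n, Phi (A n)) ->
    exists2 r : nat -> response k X, (forall n, legal (A n) (r n)) &
      Psi (outcome r) by case: k.
apply/propext; split=> [sel|[s [sl _ sw]] A PA]; last first.
  by exists (s A); [move=> n; exact: sl | exact: sw].
have /choice[s sP] (A : nat -> set X) : exists r : nat -> response k X,
    (forall n, Phi (A n)) -> (forall n, legal (A n) (r n)) /\ Psi (outcome r).
  (* On sequences with entries outside Phi any value serves. *)
  have [PA|nPA] := pselect (forall n, Phi (A n)).
    by have [r] := sel A PA; exists r.
  by have [r _ _] := sel (fun=> A0) (fun=> PA0); exists r.
exists s; split=> [A n /sP[]|A A' n _ _ AA'|A /sP[]] //.
by have -> : A = A' by apply/funext => m; exact: AA'.
Qed.

(** A finite history is extended to an infinite play by repeating some element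
    [A0] of [Phi]; locality makes the response independent of this extension.
*)
Lemma two_winsE k {X : Type} (Phi Psi : set (set X)) : Phi !=set0 ->
  two_wins k Phi Psi = informed_win k (fun n => [set m | m <= n]) Phi Psi.
Proof.
move=> [A0 PA0].
have -> : two_wins k Phi Psi = exists2 s : seq (set X) -> response k X,
    (forall h A, (forall B, B \in h -> Phi B) -> Phi A ->
      legal A (s (rcons h A))) &
    forall A : nat -> set X, (forall n, Phi (A n)) ->
      Psi (outcome (fun n => s (mkseq A n.+1))) by case: k.
apply/propext; split=> [[s sl sw]|[s [sl si sw]]].
  exists (fun A n => s (mkseq A n.+1)); split=> // [A n PA|A A' n _ _ AA'].
    by rewrite mkseqS; apply: sl => // B /mapP[m _ ->].
  congr s; apply/eq_in_map => m; rewrite mem_iota add0n ltnS => /andP[_].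
  exact: AA'.
exists (fun h => s (nth A0 h) (size h).-1) => [h A Ph PA|A PA].
  rewrite size_rcons /= -[X in legal X](_ : nth A0 (rcons h A) (size h) = A).
    apply: sl => m; have [mh|hm] := ltnP m (size (rcons h A)); last first.
      by rewrite nth_default.
    have := mem_nth A0 mh; rewrite mem_rcons inE => /orP[/eqP->|/Ph] //.
  by rewrite nth_rcons ltnn eqxx.
rewrite (_ : (fun _ => _) = s A); first exact: sw.
apply/funext => n; rewrite size_mkseq /=; apply: si => // m => [|/= mn].
  have [mn|nm] := ltnP m n.+1; first by rewrite nth_mkseq.
  by rewrite nth_default ?size_mkseq.
by rewrite nth_mkseq.
Qed.

(** Since only the current move is visible, the play may be replaced by the
    one that repeats this move forever. *)
Lemma two_markov_winsE k {X : Type} (Phi Psi : set (set X)) :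
  two_markov_wins k Phi Psi = informed_win k (fun n => [set n]) Phi Psi.
Proof.
have -> : two_markov_wins k Phi Psi = exists2 s : set X -> nat -> response k X,
    (forall A n, Phi A -> legal A (s A n)) &
    forall A : nat -> set X, (forall n, Phi (A n)) ->
      Psi (outcome (fun n => s (A n) n)) by case: k.
apply/propext; split=> [[s sl sw]|[s [sl si sw]]].
  exists (fun A n => s (A n) n); split=> // [A n PA|A A' n _ _ -> //].
  exact: sl.
exists (fun A n => s (fun=> A) n) => [A n PA|A PA].
  exact: (sl (fun=> A)).
rewrite (_ : (fun _ => _) = s A); first exact: sw.
by apply/funext => n; apply: si => // m ->.
Qed.

Theorem theorem2p2 (X : topologicalType) (k : selection_kind)
    (Phi : set (set X)) :
  infinite_set [set: X] -> hausdorff_space X -> ramsey_for k X ->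
  Phi !=set0 ->
  [/\ [<-> selection k Phi seq_dense_sets;
           seq_separable X /\ (forall x : X, selection k Phi (Gamma' x));
           exists D : set X, [/\ countable D, seq_dense D &
             forall x, D x -> selection k Phi (Gamma' x)]],
      [<-> two_wins k Phi seq_dense_sets;
           seq_separable X /\ (forall x : X, two_wins k Phi (Gamma' x));
           exists D : set X, [/\ countable D, seq_dense D &
             forall x, D x -> two_wins k Phi (Gamma' x)]] &
      [<-> two_markov_wins k Phi seq_dense_sets;
           seq_separable X /\ (forall x : X, two_markov_wins k Phi (Gamma' x));
           exists D : set X, [/\ countable D, seq_dense D &
             forall x, D x -> two_markov_wins k Phi (Gamma' x)]]].
Proof.
move=> /infinite_setN0 X0 hX /ramsey_for_ramsey rX Phi0.
have -> : @selection k X Phi = informed_win k (fun=> setT) Phi.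
  by apply/funext => Psi; exact: selectionE.
have -> : @two_wins k X Phi = informed_win k (fun n => [set m | m <= n]) Phi.
  by apply/funext => Psi; exact: two_winsE.
have -> : @two_markov_wins k X Phi = informed_win k (fun n => [set n]) Phi.
  by apply/funext => Psi; exact: two_markov_winsE.
split; apply: informed_win_equivalences => //.
- move=> e n m emono /=.
  by rewrite leq_eqVlt => /predU1P[->|/emono/ltnW].
- by move=> e n m _ ->.
Qed.
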